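(* Let $G$ be a countable abelian group. Then $\operatorname{asdim} G=0$ if and only if $G$ is a torsion group.
   Context: Asymptotic dimension of a metric space: a family $\mathcal{U}$ of subsets of a metric space $(X,d)$ is $R$-bounded if $\sup\{\operatorname{diam} U \mid U\in\mathcal{U}\}\le R$, and it is $D$-disjoint if $d(x,y)>D$ whenever $x\in U$, $y\in V$, $U,V\in\mathcal{U}$ and $U\ne V$. One says $\operatorname{asdim} X\le n$ if for every $D>0$ there are a number $R$ and $n+1$ families $\mathcal{U}_0,\dots,\mathcal{U}_n$ of subsets of $X$, each $D$-disjoint and $R$-bounded, such that $\bigcup_i\mathcal{U}_i$ is a cover of $X$; $\operatorname{asdim} X$ is the least such $n$. Asymptotic dimension of a countable group: a metric is proper if closed bounded sets are compact. Every countable group $G$ admits a left invariant proper metric (for such a metric every bounded set is finite), any two such metrics are coarsely equivalent, and asymptotic dimension is invariant under coarse equivalence. $\operatorname{asdim} G$ denotes the asymptotic dimension of $(G,d)$ for any left invariant proper metric $d$ on $G$; it does not depend on the choice of $d$. A torsion group is a group in which every element has finite order. *)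

(* Defs.v *)
From HB Require Import structures.
From mathcomp Require Import all_boot all_order all_algebra.
From mathcomp Require Import all_classical all_reals all_analysis.

Set Implicit Arguments.
Unset Strict Implicit.
Unset Printing Implicit Defensive.

Import Order.TTheory GRing.Theory Num.Theory.

Local Open Scope classical_set_scope.
Local Open Scope ring_scope.

Section AsymptoticDimension.
Context {R : realType} {X : metricType R}.
Implicit Types (A : set X) (U : set (set X)).

(* Follows the convention diam set0 = -oo, so that an empty set or an empty
   family is r-bounded for every r. *)
Definition diam A : \bar R :=
  ereal_sup [set (mdist xy.1 xy.2)%:E | xy in A `*` A].

Definition bounded_family (r : R) U : Prop :=
  (ereal_sup [set diam A | A in U] <= r%:E)%E.

Definition disjoint_family (D : R) U : Prop :=
  forall A B, U A -> U B -> A <> B ->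
  forall x y, A x -> B y -> D < mdist x y.

Definition metric_bounded A : Prop := exists r : R, (diam A <= r%:E)%E.

End AsymptoticDimension.

Definition asdim_le {R : realType} (X : metricType R) (n : nat) : Prop :=
  forall D : R, 0 < D ->
  exists (r : R) (U : 'I_n.+1 -> set (set X)),
    (forall i, disjoint_family D (U i) /\ bounded_family r (U i)) /\
    \bigcup_(A in \bigcup_i U i) A = [set: X].

(* The infimum is the least n with [asdim_le X n], and +oo if there is none. *)
Definition asdim {R : realType} (X : metricType R) : \bar R :=
  ereal_inf [set n%:R%:E | n in asdim_le X].

Definition proper_metric {R : realType} (X : metricType R) : Prop :=
  forall A : set X, closed A -> metric_bounded A -> compact A.

Record is_metric {R : realType} {T : Type} (d : T -> T -> R) : Prop := IsMetric {
  dist_refl : forall x, d x x = 0;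
  dist_positivity : forall x y, d x y = 0 -> x = y;
  dist_sym : forall x y, d x y = d y x;
  dist_triangle : forall y x z, d x z <= d x y + d y z
}.

(* A copy of T carrying the metric d and its topology: T itself may have other
   structures, and several metrics. *)
Definition metric_space {R : realType} {T : choiceType} {d : T -> T -> R}
  (d_metric : is_metric d) : Type := T.

Section MetricSpace.
Context {R : realType} {T : choiceType} {d : T -> T -> R}.
Variable d_metric : is_metric d.

HB.instance Definition _ := Choice.on (metric_space d_metric).
HB.instance Definition _ := @isMetric.Build R (metric_space d_metric) d
  (dist_refl d_metric) (dist_positivity d_metric)
  (dist_sym d_metric) (dist_triangle d_metric).

End MetricSpace.

Definition left_invariant {R : realType} {G : zmodType} (d : G -> G -> R) : Prop :=
  forall a x y : G, d (a + x) (a + y) = d x y.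

Definition torsion_group (G : zmodType) : Prop :=
  forall x : G, exists2 n : nat, (0 < n)%N & x *+ n = 0.

(* Main.v *)
Require Import Defs.
From mathcomp Require Import all_boot all_order all_algebra.
From mathcomp Require Import all_classical all_reals all_analysis.

(** A left invariant proper metric on a countable group is uniformly discrete,
    so its balls are finite: a ball is compact and countable, hence has an
    isolated point by a Baire category argument
    ([countable_proper_isolated_point]), and translations carry the isolation
    radius of one point to every other.

    Asymptotic dimension zero says that for each D > 0 the space splits into
    uniformly bounded pieces at mutual distance greater than D, so no chain of
    steps of length at most D leaves the piece in which it starts.  If [x] had
    infinite order, the chain 0, x, 2x, ... of steps of length d(0, x) would
    stay in one bounded, hence finite, piece although its members are pairwise
    distinct ([asdim_le0_torsion]).  Conversely, in a torsion abelian group the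
    finite ball of radius D around 0 lies in a finite subgroup
    ([finite_subgroup_containing]); the cosets of that subgroup are isometric to
    it and are D-disjoint, because two points at distance at most D differ by an
    element of the ball ([torsion_asdim_le0]). *)

Set Implicit Arguments.
Unset Strict Implicit.
Unset Printing Implicit Defensive.

Import Order.TTheory GRing.Theory Num.Theory.

Local Open Scope classical_set_scope.
Local Open Scope ring_scope.

Section ProperMetricSpaces.
Context {R : realType} {X : metricType R}.

Definition closed_mball (x : X) (r : R) : set X := [set y | mdist x y <= r].

Lemma diam_leP (A : set X) (r : R) :
  (diam A <= r%:E)%E <-> forall x y, A x -> A y -> mdist x y <= r.
Proof.
split=> [Ar x y Ax Ay|Ar].
  rewrite -lee_fin; apply: le_trans Ar.
  by apply: ereal_sup_ubound; exists (x, y).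
by apply: ge_ereal_sup => _ [[x y] [/= Ax Ay] <-]; rewrite lee_fin; exact: Ar.
Qed.

Lemma closed_closed_mball (x : X) (r : R) : closed (closed_mball x r).
Proof.
move=> y ymem; apply/ler_addgt0Pr => e e0.
have [z [/= xz]] := ymem _ (nbhsx_ballx y e e0).
rewrite ballEmdist /= => yz.
apply: le_trans (metric_triangle x z y) _; apply: lerD => //.
by rewrite metric_sym ltW.
Qed.

Lemma metric_bounded_closed_mball (x : X) (r : R) :
  metric_bounded (closed_mball x r).
Proof.
exists (r + r); apply/diam_leP => y z xy xz.
apply: le_trans (metric_triangle y x z) _.
by apply: lerD => //; rewrite metric_sym.
Qed.

Lemma compact_closed_mball (x : X) (r : R) :
  proper_metric X -> compact (closed_mball x r).
Proof.
by apply; [exact: closed_closed_mball|exact: metric_bounded_closed_mball].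
Qed.

Lemma shrink_closed_mball (x p y : X) (r : R) :
  mdist x y < r -> y != p ->
  exists2 s, 0 < s & closed_mball y s `<=` closed_mball x r `\ p.
Proof.
move=> xy yp; exists (Order.min (r - mdist x y) (mdist y p / 2)).
  by rewrite lt_min subr_gt0 xy divr_gt0// mdist_gt0.
move=> z; rewrite /closed_mball /= le_min => /andP[yz1 yz2]; split.
  by apply: le_trans (metric_triangle x y z) _; rewrite -lerBrDl.
move=> zp; move: yz2; rewrite zp ler_pdivlMr// mulr_natr mulr2n gerDl.
by rewrite leNgt mdist_gt0 yp.
Qed.

(** Baire category by hand: if no point were isolated, closed balls could be
    nested so that the n-th one misses the n-th point of the space, and by
    compactness of the first one they would still share a point. *)
Lemma countable_proper_isolated_point (x0 : X) :
  countable [set: X] -> proper_metric X ->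
  exists x : X, exists2 e : R, 0 < e & forall y, mdist x y < e -> y = x.
Proof.
move=> /countable_injP[code code_inj] Xproper.
apply: contrapT => no_isolated.
have near_other (x : X) (r : R) : 0 < r -> exists2 y, mdist x y < r & y != x.
  move=> r0; apply: contrapT => xr; apply: no_isolated; exists x, r => // y xy.
  by apply/eqP; apply: contrapT => /negP yx; apply: xr; exists y.
have step (n : nat) (b : X * {posnum R}) : exists c : X * {posnum R},
    closed_mball c.1 c.2%:num `<=` closed_mball b.1 b.2%:num /\
    forall p, code p = n -> ~ closed_mball c.1 c.2%:num p.
  case: b => x r /=.
  have [[p pn]|nop] := pselect (exists p, code p = n); last first.
    by exists (x, r); split=> // p pn; case: nop; exists p.
  have [y xy yp] : exists2 y : X, mdist x y < r%:num & y != p.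
    have [->|xp] := eqVneq x p; first exact: near_other.
    by exists x; rewrite ?mdistxx.
  have [s s0 sub] := shrink_closed_mball xy yp.
  exists (y, PosNum s0); split=> [z /sub[]//|q qn] /sub[_]; apply => /=.
  by apply: code_inj; rewrite ?inE// pn qn.
have [next nextP] := choice (fun nb => step nb.1 nb.2).
pose b := fix b n := if n is m.+1 then next (m, b m) else (x0, PosNum (@ltr01 R)).
pose B n := closed_mball (b n).1 (b n).2%:num.
have B_nested m n : (m <= n)%N -> B n `<=` B m.
  elim: n => [|n IHn]; first by rewrite leqn0 => /eqP ->.
  rewrite leq_eqVlt => /predU1P[->//|/IHn]; apply: subset_trans.
  exact: (nextP (n, b n)).1.
have center_in m n : (m <= n)%N -> B m (b n).1.
  by move=> mn; apply: (B_nested _ _ mn); rewrite /B /closed_mball /= mdistxx.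
have [] := @compact_closed_mball (b 0%N).1 (b 0%N).2%:num Xproper
  ((fun n => (b n).1) @ \oo) _ _.
  by exists 0%N => // n _; exact: center_in.
move=> p [_ p_cluster].
have Bp n : B n p.
  apply: closed_closed_mball => V Vp; apply: p_cluster => //.
  by exists n => // m /=; exact: center_in.
exact: (nextP (code p, b (code p))).2 _ erefl (Bp (code p).+1).
Qed.

(** If the ball were infinite, the sets omitting only finitely many of its
    points would form a proper filter.  This filter would have a cluster point p
    in the compact ball; but p is isolated and the complement of {p} belongs to
    the filter. *)
Lemma finite_closed_mball (e : R) (x : X) (r : R) : 0 < e ->
  (forall y z : X, mdist y z < e -> y = z) -> proper_metric X ->
  finite_set (closed_mball x r).
Proof.
move=> e0 discr Xproper; apply: contrapT => ball_infinite.
pose F : set_system X := [set B | finite_set (closed_mball x r `\` B)].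
have F_filter : ProperFilter F.
  split; first by rewrite /F /= setD0.
  split; first by rewrite /F /= setDT.
    by move=> B C FB FC; rewrite /F /= setDIr finite_setU.
  by move=> B C BC; apply: sub_finite_set; exact: setDS.
have [] := @compact_closed_mball x r Xproper F F_filter _.
  by rewrite /F /= setDv.
move=> p [_ p_cluster].
have F_compl : F (~` [set p]).
  by apply: (@sub_finite_set _ _ [set p]) => // z [_] /contrapT.
have [z [zp]] := p_cluster _ _ F_compl (nbhsx_ballx p e e0).
by rewrite ballEmdist => /discr /esym.
Qed.

Lemma asdim_eq0 : asdim X = 0%E <-> asdim_le X 0.
Proof.
split=> [X0|X0]; last first.
  apply/le_anti/andP; split; first by apply: ereal_inf_lbound; exists 0%N.
  by apply: le_ereal_inf_tmp => _ [n _ <-]; rewrite lee_fin.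
have : (ereal_inf [set (n%:R : R)%:E | n in asdim_le X] < 1)%E.
  by rewrite -/(asdim X) X0 lte_fin.
case/ereal_inf_lt => _ [[|n] Xn <-] //.
by rewrite lte_fin ltrn1.
Qed.

End ProperMetricSpaces.

(** The sums h + ix with [h] in a finite subgroup and i below an exponent
    killing [x] form a finite subgroup again, so the generators can be adjoined
    one at a time.  Commutativity is essential here. *)
Lemma finite_subgroup_containing (G : zmodType) (s : seq G) :
  torsion_group G ->
  exists2 H : seq G, zmod_closed [in H] & {subset s <= H}.
Proof.
move=> Gtors; elim: s => [|x s [H [H0 HB] sH]].
  exists [:: 0] => //; split=> [|u v]; rewrite !inE// => /eqP-> /eqP->.
  by rewrite subr0.
have [n n0 xn] := Gtors x.
have xmod m : x *+ (m %% n) = x *+ m.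
  by rewrite {2}(divn_eq m n) mulrnDr mulnC mulrnA xn mul0rn add0r.
have mem_sum h m : h \in H -> h + x *+ m \in [seq h + x *+ i | h <- H, i <- iota 0 n].
  move=> hH; rewrite -xmod; apply: allpairs_f => //.
  by rewrite mem_iota /= add0n ltn_mod.
exists [seq h + x *+ i | h <- H, i <- iota 0 n].
  split=> [|_ _ /allpairsP[[h i] /= [hH _ ->]] /allpairsP[[k j] /= [kH jn ->]]].
    by have := mem_sum 0 0%N H0; rewrite mulr0n addr0.
  move: jn; rewrite mem_iota /= add0n => jn.
  (* subtracting jx amounts to adding (n - j)x *)
  have -> : h + x *+ i - (k + x *+ j) = h - k + x *+ (i + (n - j)).
    by rewrite mulrnDr mulrnBr ?(ltnW jn)// xn sub0r opprD addrACA.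
  by apply: mem_sum; exact: HB.
move=> y; rewrite inE => /predU1P[->|/sH yH].
  by have := mem_sum 0 1%N H0; rewrite mulr1n add0r.
by have := mem_sum y 0%N yH; rewrite mulr0n addr0.
Qed.

Section InvariantMetrics.
Context {R : realType} {G : zmodType} {d : G -> G -> R}.
Variables (d_metric : is_metric d) (d_invariant : left_invariant d).

Local Notation X := (metric_space d_metric).

Lemma invariant_dist_sub (x y : G) : d x y = d 0 (y - x).
Proof. by rewrite -(d_invariant (- x)) addNr addrC. Qed.

Lemma countable_proper_finite_balls (r : R) :
  countable [set: G] -> proper_metric X -> finite_set [set x : G | d 0 x <= r].
Proof.
move=> Gcount Xproper.
have [x [e e0 xe]] := countable_proper_isolated_point ((0 : G) : X) Gcount Xproper.
apply: (@finite_closed_mball R X e 0 r e0 _ Xproper) => y z yz.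
have /xe : d x (x + (z - y)) < e.
  by rewrite invariant_dist_sub addrC addKr -invariant_dist_sub.
by move/eqP; rewrite -subr_eq0 addrC addKr subr_eq0 => /eqP.
Qed.

Lemma asdim_le0_torsion : (forall r, finite_set [set x : G | d 0 x <= r]) ->
  asdim_le X 0 -> torsion_group G.
Proof.
move=> finite_ball X0 x; apply: contrapT => xtors.
have xn0 n : (0 < n)%N -> x *+ n <> 0 by move=> n0 xn; apply: xtors; exists n.
have d0x : 0 < d 0 x.
  by rewrite (@mdist_gt0 R X) eq_sym; apply/eqP; rewrite -[x]mulr1n; exact: xn0.
have [r [U [UP Ucover]]] := X0 _ d0x.
have block y : exists2 A, U ord0 A & A y.
  have [A [i _ UA] Ay] : (\bigcup_(A in \bigcup_i U i) A) y by rewrite Ucover.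
  by exists A => //; rewrite -[ord0](ord1 i).
have [Udisj Ubdd] := UP ord0.
have [A UA A0] := block 0.
have Amul n : A (x *+ n).
  elim: n => [//|n An]; have [B UB Bn] := block (x *+ n.+1).
  have [->//|AB] := pselect (A = B).
  have : d 0 x < d (x *+ n) (x *+ n.+1) by exact: Udisj UA UB AB _ _ An Bn.
  by rewrite [X in _ < X]invariant_dist_sub mulrSr addrC addKr ltxx.
have Ar : (diam A <= r%:E)%E.
  by apply: le_trans Ubdd; apply: ereal_sup_ubound; exists A.
apply: infinite_nat; apply: (@sub_finite_set _ _ ((fun n => x *+ n) @^-1` [set x : G | d 0 x <= r])).
  by move=> n _; exact: (diam_leP A r).1 Ar _ _ A0 (Amul n).
apply: finite_preimage (finite_ball r) => m n _ _.
wlog mn : m n / (m <= n)%N.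
  by move=> wl xmn; have [/wl|/ltnW/wl] := leqP m n; [exact|move=> ->].
move=> xmn; apply/eqP; rewrite eqn_leq mn /= leqNgt; apply/negP => m_lt_n.
by apply: (xn0 (n - m)%N); rewrite ?subn_gt0// mulrnBr// xmn subrr.
Qed.

Lemma torsion_asdim_le0 : (forall r, finite_set [set x : G | d 0 x <= r]) ->
  torsion_group G -> asdim_le X 0.
Proof.
move=> finite_ball Gtors D D0.
have /finite_seqP[s sE] := finite_ball D.
have [H [H0 HB] sH] := finite_subgroup_containing s Gtors.
have HN u : u \in H -> - u \in H by rewrite -[- u]sub0r; exact: HB.
have HD u v : u \in H -> v \in H -> u + v \in H.
  by move=> uH vH; rewrite -[v]opprK; apply: HB => //; exact: HN.
pose coset (x : G) : set X := [set y : G | y - x \in H].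
exists (\sum_(h <- H) d 0 h), (fun=> range coset); split=> [_|]; last first.
  apply/seteqP; split=> // x _; exists (coset x); last by rewrite /coset /= subrr.
  by exists ord0 => //; exists x.
split.
  move=> _ _ [x _ <-] [y _ <-] xy u v ux vy.
  rewrite ltNge; apply/negP => uvD; apply: xy.
  have uvH : v - u \in H.
    apply: sH; have : [set x : G | d 0 x <= D] (v - u).
      by rewrite /= -invariant_dist_sub.
    by rewrite sE.
  have xyH : y - x \in H.
    rewrite -[y - x](subrKA u) -[y - u](subrKA v) addrC addrA.
    by rewrite HD// HD// -opprB HN.
  apply/seteqP; split=> z /= zH.
    by rewrite /coset /= -(subrKA x) -[x - y]opprB HD// HN.
  by rewrite /coset /= -(subrKA y) HD.
apply: ge_ereal_sup => _ [_ [x _ <-] <-]; apply/diam_leP => u v ux vx.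
have uvH : v - u \in H.
  by rewrite -(subrKA x) -[x - u]opprB HD// HN.
rewrite /mdist /= invariant_dist_sub.
rewrite (big_rem (v - u))//= lerDl; apply: sumr_ge0 => h _.
exact: (@mdist_ge0 R X).
Qed.

End InvariantMetrics.

Unset Implicit Arguments.

Theorem corollary2 (R : realType) (G : zmodType)
    (G_countable : countable [set: G])
    (d : G -> G -> R) (d_metric : is_metric d)
    (d_invariant : left_invariant d)
    (d_proper : proper_metric (metric_space d_metric)) :
  asdim (metric_space d_metric) = 0%E <-> torsion_group G.
Proof.
have finite_ball r :=
  countable_proper_finite_balls d_invariant r G_countable d_proper.
rewrite asdim_eq0; split; first exact: asdim_le0_torsion.
exact: torsion_asdim_le0.
Qed.
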